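(* For every $0<\gamma<1$, \[ \max_{l\geq1}\max_{0<t<1}\frac{\theta\left(t^{\gamma};l\right)}{1+t+\cdots+t^{l-1}}\geq\Gamma_{\chi}\sqrt{\frac{1}{\gamma}}, \] where the outer maximum is over integers $l\geq1$ and $\Gamma_{\chi}=\sqrt{\frac{\pi}{2}}\max_{0<u<\infty}\frac{1-e^{-u}}{\sqrt{u}}$.
   Context: The truncated theta function is $\theta(t;l)=\sum_{j=1}^{l}t^{\binom{j}{2}}=1+t+t^{3}+t^{6}+\cdots+t^{\binom{l}{2}}$. *)

(* Defs.v *)
From mathcomp Require Import all_boot all_order all_algebra.
From mathcomp Require Import all_classical all_reals all_analysis.
Import Order.TTheory GRing.Theory Num.Theory.

Set Implicit Arguments.
Unset Strict Implicit.
Unset Printing Implicit Defensive.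

Local Open Scope classical_set_scope.
Local Open Scope ring_scope.

(* [maxima A] has at most one element; [max_set A] is that element when it
   exists and the junk value 0 otherwise, so it is meaningful only together
   with [has_max A]. *)
Definition maxima (R : realType) (A : set R) : set R := A `&` ubound A.

Definition has_max (R : realType) (A : set R) : Prop := maxima A !=set0.

Definition max_set (R : realType) (A : set R) : R := xget 0 (maxima A).

Definition theta (R : realType) (t : R) (l : nat) : R :=
  \sum_(1 <= j < l.+1) t ^+ 'C(j, 2).

Definition theta_ratio (R : realType) (gamma : R) (l : nat) (t : R) : R :=
  theta (t `^ gamma) l / \sum_(0 <= k < l) t ^+ k.

Definition theta_ratios (R : realType) (gamma : R) (l : nat) : set R :=
  [set theta_ratio gamma l t | t in [set t : R | 0 < t < 1]].

Definition max_theta_ratios (R : realType) (gamma : R) : set R :=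
  [set max_set (theta_ratios gamma l) | l in [set l : nat | (1 <= l)%N]].

Definition chi_values (R : realType) : set R :=
  [set (1 - expR (- u)) / Num.sqrt u | u in [set u : R | 0 < u]].

Arguments chi_values : clear implicits.

Definition Gamma_chi (R : realType) : R :=
  Num.sqrt (pi / 2) * max_set (chi_values R).

Arguments Gamma_chi : clear implicits.

(* Main.v *)
(* Write [t = expR (- u)] and [2 * b ^+ 2 = gamma * u]. Slice the half-line at the
   points [b * (k + 1/2)]. On each slice the Gaussian [expR (- z ^+ 2)] is at most
   the exponential of an affine function whose values at the two ends are the
   consecutive theta terms [expR (- b ^+ 2 * k * (k + 1))], so by convexity its
   integral is at most [b] times the average of these terms. Summing up, the
   infinite theta series is at least [Num.sqrt pi / (2 * b)] for every [b > 0], and,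
   as [1 + ... + t ^+ l.-1 <= (1 - t)^-1], letting [l] go to infinity gives the
   lower bound. The maximum over [l] is attained because the maximal ratio is at
   least 1 and, once [gamma * l.+1 >= 2], is nonincreasing in [l]. *)
Require Import Defs.
From mathcomp Require Import all_boot all_order all_algebra.
From mathcomp Require Import all_classical all_reals all_analysis.
From mathcomp Require Import measurable_realfun.
From mathcomp Require Import ring lra.
Import Order.TTheory GRing.Theory Num.Theory.
Import numFieldNormedType.Exports.
Local Open Scope classical_set_scope.
Local Open Scope ring_scope.

(** * Comparison of the Gaussian integral with the theta series *)

Lemma expR_chord (R : realType) (s x y : R) : 0 <= s <= 1 ->
  expR ((1 - s) * x + s * y) <= (1 - s) * expR x + s * expR y.
Proof.
move=> /andP[s0 s1].
have := convex_expR (Itv01 s0 s1) y x.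
rewrite !convRE /= => h.
by rewrite addrC [leRHS]addrC.
Qed.

(** Since [k * (k + 1) = (k + 1/2) ^+ 2 - 1/4], the term lies just above the Gaussian at the slice
    end [b * (k + 1/2)]. *)
Lemma expR_bin2 (R : realType) (b : R) (k : nat) :
  expR (- (2 * b ^+ 2)) ^+ 'C(k.+1, 2) = expR (- (b ^+ 2 * (k%:R * (k%:R + 1)))).
Proof.
rewrite -expRM_natl; congr expR.
have : ('C(k.+1, 2)%:R * 2 = k%:R * (k%:R + 1) :> R).
  rewrite natr1 -!natrM; congr _%:R.
  by rewrite bin2 muln2 even_halfK 1?mulnC //= oddM /= andbN.
by move=> <-; ring.
Qed.

(* With [z = b * y], [y ^+ 2 >= 2 * k.+1 * y - k.+1 ^+ 2] bounds the Gaussian by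
   an exponential, and the exponential lies below its chord. *)
Lemma gauss_fun_le_chord (R : realType) (b z : R) (k : nat)
    (g := fun k => expR (- (2 * b ^+ 2)) ^+ 'C(k.+1, 2)) : 0 < b ->
  b * (k%:R + 2^-1) <= z <= b * (k%:R + 2^-1) + b ->
  gauss_fun z <= g k + (z - b * (k%:R + 2^-1)) / b * (g k.+1 - g k).
Proof.
move=> b0 /andP[z1 z2]; rewrite /g !expR_bin2 -[in k.+1%:R]natr1.
set s := (z - _) / b.
have zE : z = b * (k%:R + 2^-1) + b * s by rewrite /s; field; rewrite gt_eqF.
have s01 : 0 <= s <= 1.
  rewrite /s ler_pdivlMr // ler_pdivrMr // mul0r mul1r subr_ge0 lerBlDl.
  by rewrite z1 z2.
set x := - _; set y := - (b ^+ 2 * ((k%:R + 1) * _)).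
rewrite (_ : _ + s * _ = (1 - s) * expR x + s * expR y); last by ring.
apply: le_trans (expR_chord _ _ _ _ s01).
rewrite /gauss_fun ler_expR.
(* The two exponents differ by exactly this square: they touch at the midpoint [s = 1/2], that is
   [z = b * k.+1]. *)
have : 0 <= (b * (s - 2^-1)) ^+ 2 by exact: sqr_ge0.
have -> : - z ^+ 2 = (1 - s) * x + s * y - (b * (s - 2^-1)) ^+ 2.
  by rewrite zE /x /y; field.
lra.
Qed.

Lemma integral_affine (R : realType) (a c A B : R) : a < c ->
  (\int[lebesgue_measure]_(x in `[a, c]) (A + (x - a) / (c - a) * (B - A))%:E =
    ((c - a) * ((A + B) / 2))%:E)%E.
Proof.
move=> ac.
have ca : c - a != 0 by rewrite subr_eq0 gt_eqF.
pose F (x : R) := A * x + (B - A) / (2 * (c - a)) * (x - a) ^+ 2.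
have dF x : is_derive x (1 : R) F (A + (x - a) / (c - a) * (B - A)).
  rewrite /F; apply: is_derive_eq; rewrite /GRing.scale /=.
  by field.
rewrite (@continuous_FTC2 _ _ F) //.
- by rewrite -EFinB /F; congr EFin; field.
- apply: continuous_subspaceT => x.
  apply: differentiable_continuous; apply/derivable1_diffP.
  by [].
- have cF x : F @ x --> F x.
    by apply: differentiable_continuous; apply/derivable1_diffP.
  split.
  + by move=> x _.
  + exact: cvg_at_right_filter.
  + exact: cvg_at_left_filter.
- by move=> x _; rewrite derive1E derive_val.
Qed.

Lemma measurable_EFin_gauss_fun (R : realType) (D : set (measurableTypeR R)) :
  measurable_fun D (EFin \o @gauss_fun R).
Proof. by apply/measurable_EFinP/measurable_funTS; exact: measurable_gauss_fun. Qed.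

(** The trapezoids on the slices give [g 0] and [g n] weight [b / 2] and the other terms weight [b].
    The initial half slice, where the Gaussian is at most [1 = g 0], supplies the missing half of
    [g 0]. *)
Lemma integral_gauss_fun_le_bin2 (R : realType) (b : R) (n : nat)
    (g := fun k => expR (- (2 * b ^+ 2)) ^+ 'C(k.+1, 2)) : 0 < b ->
  (\int[lebesgue_measure]_(z in `[0%R, (b * (n%:R + 2^-1))%R]) (gauss_fun z)%:E <=
    (b * \sum_(k < n.+1) g k - b / 2 * g n)%:E)%E.
Proof.
move=> b0.
have mgauss := @measurable_EFin_gauss_fun R.
elim: n => [|n IHn].
  rewrite big_ord1 /g bin_small // expr0 !mulr1 add0r.
  rewrite (_ : b - _ = b * 2^-1); last by field.
  apply: (@le_trans _ _ (\int[lebesgue_measure]_(z in `[0%R, (b * 2^-1)%R]) cst 1%E z)%E).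
    apply: ge0_le_integral => //=.
    - by move=> z _; rewrite lee_fin gauss_fun_ge0.
    - by move=> z _; rewrite lee_fin gauss_fun_le1.
  rewrite integral_cst //= mul1e.
  rewrite lebesgue_measure_itv /= lte_fin mulr_gt0 ?invr_gt0 //.
  by rewrite sube0.
set c := b * (n%:R + 2^-1) in IHn *.
have -> : b * (n.+1%:R + 2^-1) = c + b by rewrite /c -natr1; ring.
have c0 : 0 <= c by rewrite mulr_ge0 ?ltW // addr_ge0.
rewrite (@itv_bndbnd_setU _ _ _ (BRight c)) ?bnd_simp //; last by rewrite lerDl ltW.
rewrite ge0_integral_setU //=; first last.
- rewrite disj_set2E; apply/eqP/seteqP; split => // z /=.
  by rewrite !in_itv/= => -[/andP[_ zc] /andP[]]; rewrite ltNge zc.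
- by move=> z _; rewrite lee_fin gauss_fun_ge0.
have : (\int[lebesgue_measure]_(z in `]c, (c + b)%R]) (gauss_fun z)%:E <=
    (b * ((g n + g n.+1) / 2))%:E)%E.
  rewrite integral_itv_obnd_cbnd; last exact: mgauss.
  have cb : c < c + b by rewrite ltrDl.
  have := integral_affine R c (c + b) (g n) (g n.+1) cb.
  rewrite addrAC subrr add0r => <-.
  apply: ge0_le_integral => //=.
  - by move=> z _; rewrite lee_fin gauss_fun_ge0.
  - apply/measurable_EFinP; apply: measurable_funD => //.
    by apply: measurable_funM => //; apply: measurable_funM => //; apply: measurable_funB.
  - move=> z; rewrite in_itv/= => zc; rewrite lee_fin.
    exact: gauss_fun_le_chord.
move=> /(leeD IHn)/le_trans; apply.
rewrite -EFinD lee_fin [in leRHS]big_ord_recr /= le_eqVlt; apply/orP; left; apply/eqP.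
by field.
Qed.

Lemma sum_bin2_lower_bound (R : realType) (b B : R) : 0 < b ->
  (forall n, \sum_(k < n) expR (- (2 * b ^+ 2)) ^+ 'C(k.+1, 2) <= B) ->
  Num.sqrt pi / (2 * b) <= B.
Proof.
move=> b0 hB.
have mgauss := @measurable_EFin_gauss_fun R.
have h m : (\int[lebesgue_measure]_(z in `[0%R, m.+1%:R]) (gauss_fun z)%:E <= (b * B)%:E)%E.
  (* This makes [b * n.+1%:R] exceed [m.+1%:R], so the slices cover the interval. *)
  pose n := Num.truncn (m.+1%:R / b).
  have mn : m.+1%:R <= b * (n.+1%:R + 2^-1).
    have : m.+1%:R / b < n.+1%:R by rewrite /n truncnS_gt.
    by rewrite ltr_pdivrMr //; nra.
  apply: (@le_trans _ _
      (\int[lebesgue_measure]_(z in `[0%R, (b * (n.+1%:R + 2^-1))%R]) (gauss_fun z)%:E)%E).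
    apply: ge0_subset_integral => //=.
    - by move=> z _; rewrite lee_fin gauss_fun_ge0.
    - by apply: subset_itvl; rewrite bnd_simp.
  apply: le_trans (integral_gauss_fun_le_bin2 _ _ n.+1 b0) _.
  rewrite lee_fin; have := hB n.+2; rewrite -(ler_pM2l b0).
  have : 0 <= b / 2 * expR (- (2 * b ^+ 2)) ^+ 'C(n.+2, 2).
    by rewrite mulr_ge0 ?exprn_ge0 ?expR_ge0// divr_ge0 ?ltW.
  lra.
have : ((Num.sqrt pi / 2)%:E <= (b * B)%:E)%E.
  rewrite -integral0y_gauss.
  rewrite (ge0_integral_ereal_sup _ gauss_fun_ge0 measurable_gauss_fun).
  by apply: ge_ereal_sup => /= _ [m _ <-]; exact: h.
by rewrite lee_fin => hb; rewrite invfM mulrA ler_pdivrMr // [leRHS]mulrC.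
Qed.

(** * Attainment of the maximum in [Gamma_chi] *)

Lemma max_setP (R : realType) (A : set R) :
  has_max A -> A (max_set A) /\ ubound A (max_set A).
Proof. by move=> /(xgetPex 0). Qed.

Lemma has_max_image (R : realType) (D : set R) (f : R -> R) (a b c : R) :
  {within `[a, b], continuous f} -> `[a, b] `<=` D -> c \in `[a, b] ->
  (forall t, D t -> t \notin `[a, b] -> f t <= f c) ->
  has_max [set f t | t in D].
Proof.
move=> cf abD cab fout.
have ab : a <= b by move: cab; rewrite in_itv/= => /andP[]; exact: le_trans.
have [d dab fd] := EVT_max ab cf.
exists (f d); split; first by exists d => //; exact: abD.
move=> _ [t Dt <-]; have [tab|tab] := boolP (t \in `[a, b]); first exact: fd.
exact: le_trans (fout _ Dt tab) (fd _ cab).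
Qed.

(** The value at 1 is at least 1/2 because [expR 1 >= 2], while the bounds [Num.sqrt u] and
    [(Num.sqrt u)^-1] are at most 1/2 outside [[1/4, 4]]. *)
Lemma has_max_chi_values (R : realType) : has_max (chi_values R).
Proof.
pose f (u : R) := (1 - expR (- u)) / Num.sqrt u.
have f1 : 2^-1 <= f 1.
  rewrite /f sqrtr1 divr1 expRN.
  have : 2 <= expR 1 :> R by have := expR_ge1Dx (1 : R); lra.
  by rewrite -[_ <= expR 1]lef_pV2 ?posrE ?expR_gt0 //; lra.
have f_small (u : R) : 0 < u -> f u <= Num.sqrt u.
  move=> u0; rewrite /f ler_pdivrMr ?sqrtr_gt0 // -expr2 sqr_sqrtr ?(ltW u0) //.
  have := expR_ge1Dx (- u); lra.
have f_large (u : R) : 0 < u -> f u <= (Num.sqrt u)^-1.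
  move=> u0; rewrite /f ler_pdivrMr ?sqrtr_gt0 // mulVf ?gt_eqF ?sqrtr_gt0 //.
have s4 : Num.sqrt (4^-1 : R) = 2^-1.
  by rewrite (_ : 4^-1 = 2^-1 ^+ 2) ?sqrtr_sqr ?ger0_norm //; field.
have s4' : Num.sqrt (4 : R) = 2.
  by rewrite (_ : 4 = 2 ^+ 2) ?sqrtr_sqr ?ger0_norm //; ring.
apply: (@has_max_image _ _ f 4^-1 4 1).
- apply: continuous_in_subspaceT => u; rewrite inE /= in_itv /= => /andP[u1 _].
  have u0 : 0 < u by exact: lt_le_trans u1.
  apply: cvgM.
    apply: cvgB; first exact: cvg_cst.
    by apply: continuous_comp; [exact: cvgN|exact: continuous_expR].
  by apply: cvgV; [rewrite gt_eqF ?sqrtr_gt0|exact: sqrt_continuous].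
- by move=> u /=; rewrite in_itv /= => /andP[u1 _]; exact: lt_le_trans u1.
- by rewrite in_itv /=; apply/andP; split; lra.
- move=> u /= u0; rewrite in_itv /= negb_and -!ltNge => /orP[u4|u4].
    apply: le_trans (f_small _ u0) _; apply: le_trans f1.
    by rewrite -s4 ler_wsqrtr // ltW.
  apply: le_trans (f_large _ u0) _; apply: le_trans f1.
  rewrite lef_pV2 ?posrE ?sqrtr_gt0 //.
  by rewrite -s4' ler_wsqrtr // ltW.
Qed.

(** * Attainment of the maxima of the theta ratios *)

Lemma theta_ratioE (R : realType) (gamma t : R) (l : nat) :
  theta_ratio gamma l t =
  (\sum_(k < l) (t `^ gamma) ^+ 'C(k.+1, 2)) / \sum_(k < l) t ^+ k.
Proof. by rewrite /theta_ratio /theta big_add1 /= !big_mkord. Qed.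

Lemma sum_expr_gt0 (R : realType) (t : R) (l : nat) : 0 <= t ->
  0 < \sum_(k < l.+1) t ^+ k.
Proof.
move=> t0; rewrite big_ord_recl expr0 ltr_pwDl // sumr_ge0 // => k _.
exact: exprn_ge0.
Qed.

Lemma sum_expr_le (R : realType) (t : R) (l : nat) : 0 <= t < 1 ->
  \sum_(k < l) t ^+ k <= (1 - t)^-1.
Proof.
move=> /andP[t0 t1]; rewrite -[leRHS]mul1r ler_pdivlMr ?subr_gt0 // mulrC.
have := subrX1 t l; have := exprn_ge0 l t0.
move=> h e; lra.
Qed.

Lemma continuous_theta_ratio (R : realType) (gamma : R) (l : nat) : 0 < gamma ->
  {within `[0, 1], continuous (theta_ratio gamma l.+1)}.
Proof.
move=> g0.
have csum (e : nat -> nat) : continuous (fun x : R => \sum_(k < l.+1) x ^+ e k).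
  apply: continuous_big => [|k _]; first exact: add_continuous.
  exact: exprn_continuous.
have cratio (F : set_system R) (x : R) : Filter F -> 0 <= x -> F --> x ->
    t `^ gamma @[t --> F] --> x `^ gamma ->
    theta_ratio gamma l.+1 t @[t --> F] --> theta_ratio gamma l.+1 x.
  move=> FF x0 Fx Fxg; rewrite theta_ratioE.
  under eq_cvg do rewrite theta_ratioE.
  apply: cvgM; first exact: cvg_comp Fxg (csum (fun k => 'C(k.+1, 2)) _).
  apply: cvgV; first by rewrite gt_eqF ?sum_expr_gt0.
  exact: cvg_comp Fx (csum id _).
have cpow (t : R) : 0 < t -> {for t, continuous (fun t : R => t `^ gamma)}.
  move=> t0; apply: differentiable_continuous; apply/derivable1_diffP.
  by apply: derivable_powR; rewrite in_itv /= t0.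
apply/continuous_within_itvP => //; split.
- move=> t; rewrite in_itv /= => /andP[t0 _].
  by apply: cratio; [exact: ltW|exact: cvg_id|exact: cpow].
(* At the end 0 continuity of the power comes from [0 < gamma] rather than from derivability. *)
- apply: cratio => //; first exact: cvg_at_right_filter cvg_id.
  by rewrite powR0 ?gt_eqF //; exact: powR_cvg0.
- apply: cratio => //; first exact: cvg_at_left_filter cvg_id.
  by apply: cvg_at_left_filter; exact: cpow.
Qed.

Lemma theta_ratio_ge1 (R : realType) (gamma : R) : 0 < gamma < 1 ->
  exists2 t : R, 0 < t < 1 & forall l, 1 <= theta_ratio gamma l.+1 t.
Proof.
move=> /andP[g0 g1].
pose t : R := 2^-1 `^ (1 - gamma)^-1.
have g1' : 1 - gamma != 0 by rewrite subr_eq0 gt_eqF.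
have t0 : 0 < t by rewrite powR_gt0.
have tp : t `^ (1 - gamma) = 2^-1.
  by rewrite /t -powRrM mulVf // powRr1.
have t12 : t <= 2^-1.
  rewrite -[leRHS]powRr1 // /t ger_powR //; first by apply/andP; split; lra.
  rewrite invf_ge1; lra.
have tg : t `^ gamma = 2 * t.
  have : t = t `^ gamma * t `^ (1 - gamma).
    rewrite -powRD; last by rewrite (gt_eqF t0) implybT.
    by rewrite addrC subrK powRr1 // ltW.
  by rewrite tp => e; lra.
exists t; first by rewrite t0 /=; lra.
move=> l; rewrite theta_ratioE ler_pdivlMr ?sum_expr_gt0 ?(ltW t0) // mul1r.
case: l => [|l]; first by rewrite !big_ord1 bin_small // !expr0.
apply: (@le_trans _ _ (1 + 2 * t)); last first.
  rewrite 2!big_ord_recl /= bin_small // expr0 tg (_ : bump 0 0 = 1%N) // binn expr1.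
  rewrite lerD2l lerDl sumr_ge0 // => k _; rewrite exprn_ge0 // mulr_ge0 //.
  exact: ltW.
apply: le_trans (sum_expr_le _ _ _ _) _; first by rewrite ltW //=; lra.
by rewrite -[leLHS]mul1r ler_pdivrMr; nra.
Qed.

(** A maximizer on the closed interval [[0, 1]] may be an end point, but the ratio is 1 at both
    ends, and the interior point [t0] does at least as well. *)
Lemma has_max_theta_ratios (R : realType) (gamma : R) (l : nat) : 0 < gamma < 1 ->
  has_max (theta_ratios gamma l.+1).
Proof.
move=> hg; have [t0 t001 t0P] := theta_ratio_ge1 _ _ hg.
have /andP[g0 g1] := hg.
have [c] := EVT_max ler01 (continuous_theta_ratio _ _ l g0).
rewrite in_itv /= => /andP[c0 c1] cP.
have maxi d : 0 < d < 1 -> theta_ratio gamma l.+1 c <= theta_ratio gamma l.+1 d ->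
    has_max (theta_ratios gamma l.+1).
  move=> d01 cd; exists (theta_ratio gamma l.+1 d); split; first by exists d.
  move=> _ [t /= /andP[t_gt0 t_lt1] <-]; apply: le_trans cd; apply: cP.
  by rewrite in_itv /= !ltW.
have [c00|c00] := eqVneq c 0.
  apply: (maxi t0) => //; apply: le_trans (t0P l).
  rewrite theta_ratioE c00 powR0 ?gt_eqF // !big_ord_recl !expr0.
  rewrite !big1 ?addr0 ?divr1 // => i _; rewrite expr0n //=.
  by rewrite -(prednK (_ : 0 < 'C(_, 2))%N) // bin_gt0.
have [c11|c11] := eqVneq c 1.
  apply: (maxi t0) => //; apply: le_trans (t0P l).
  rewrite theta_ratioE c11 powR1.
  have -> : \sum_(k < l.+1) (1 : R) ^+ 'C(k.+1, 2) = \sum_(k < l.+1) 1 ^+ k.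
    by apply: eq_bigr => k _; rewrite !expr1n.
  by rewrite divff // gt_eqF // sum_expr_gt0.
by apply: (maxi c); rewrite // lt_neqAle eq_sym c00 c0 lt_neqAle c11 c1.
Qed.

(* By the mediant inequality, appending to the numerator a term not larger than
   the one appended to the denominator cannot raise a ratio that ends up at least 1. *)
Lemma theta_ratio_le_prev (R : realType) (gamma t : R) (l : nat) : 0 < t < 1 ->
  2 <= gamma * l.+2%:R -> 1 <= theta_ratio gamma l.+2 t ->
  theta_ratio gamma l.+2 t <= theta_ratio gamma l.+1 t.
Proof.
move=> /andP[t0 t1] gl; rewrite !theta_ratioE.
rewrite [\sum_(_ < l.+2) _ ^+ 'C(_, 2)]big_ord_recr [\sum_(_ < l.+2) t ^+ _]big_ord_recr /=.
set A := \sum_(_ < _) _; set B := \sum_(_ < _) _.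
have B0 : 0 < B by rewrite sum_expr_gt0 // ltW.
have d0 : 0 < t ^+ l.+1 by exact: exprn_gt0.
have cd : (t `^ gamma) ^+ 'C(l.+2, 2) <= t ^+ l.+1.
  rewrite -!powR_mulrn ?powR_ge0 ?(ltW t0) // -powRrM ger_powR ?t0 ?(ltW t1) //.
  (* With this identity, [2 <= gamma * l.+2%:R] says that the exponent [gamma * 'C(l.+2, 2)%:R] is
     at least [l.+1%:R]. *)
  have e : ('C(l.+2, 2)%:R * 2 = l.+2%:R * l.+1%:R :> R).
    by rewrite -!natrM; congr _%:R; rewrite bin2 muln2 even_halfK // oddM oddS andNb.
  have : 2 * l.+1%:R <= gamma * l.+2%:R * l.+1%:R :> R by rewrite ler_wpM2r.
  rewrite -mulrA -e; lra.
rewrite ler_pdivlMr ?addr_gt0 // mul1r => AB.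
have {}AB : B <= A by lra.
rewrite ler_pdivrMr ?addr_gt0 // mulrAC ler_pdivlMr // mulrDl mulrDr lerD2l.
rewrite [A * _]mulrC; apply: ler_pM => //; first by rewrite exprn_ge0 ?powR_ge0.
exact: ltW.
Qed.

Lemma max_of_eventually_nonincreasing (R : realType) (f : nat -> R) (N : nat) :
  (forall l, (N <= l)%N -> f l.+1 <= f l) -> exists m, forall l, f l <= f m.
Proof.
move=> fN; case: (@arg_maxP _ _ 'I_N.+1 ord0 xpredT (fun i => f i)) => // i _ imax.
have iP (j : 'I_N.+1) : f j <= f i by exact: imax.
exists i => l; have [lN|/ltnW Nl] := leqP l N.
  exact: (iP (Ordinal (lN : (l < N.+1)%N))).
apply: le_trans (iP ord_max); rewrite -(subnKC Nl) /=.
elim: (l - N)%N => [|k IHk]; first by rewrite addn0.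
by rewrite addnS; apply: le_trans (fN _ _) IHk; exact: leq_addr.
Qed.

Lemma has_max_max_theta_ratios (R : realType) (gamma : R) : 0 < gamma < 1 ->
  has_max (max_theta_ratios gamma).
Proof.
move=> hg; have /andP[g0 _] := hg.
pose m l := max_set (theta_ratios gamma l.+1).
have mP l := max_setP _ _ (has_max_theta_ratios _ _ l hg).
have [k kP] : exists k, forall l, m l <= m k.
  (* Past this threshold [gamma * l.+2%:R >= 2], so the mediant bound applies at a maximizer for
     [l.+2], whose ratio is at least 1. *)
  apply: (@max_of_eventually_nonincreasing _ _ (Num.truncn (2 / gamma))) => l hl.
  have [[t /= t01 tE] tmax] := mP l.+1.
  have m1 : 1 <= m l.+1.
    have [s s01 sP] := theta_ratio_ge1 _ _ hg.
    by apply: le_trans (sP l.+1) _; apply: tmax; exists s.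
  rewrite /m -tE; apply: le_trans (theta_ratio_le_prev _ _ _ _ t01 _ _) _.
  - rewrite mulrC -ler_pdivrMr //; apply: ltW; apply: lt_le_trans (truncnS_gt _) _.
    by rewrite ler_nat ltnS ltnW.
  - by rewrite tE.
  - by apply: (mP l).2; exists t.
exists (m k); split; first by exists k.+1.
by move=> _ [[|l] //= _ <-]; exact: kP.
Qed.

Theorem theorem1p4 (R : realType) (gamma : R) (hgamma : 0 < gamma < 1) :
  [/\ has_max (chi_values R),
      forall l : nat, (1 <= l)%N -> has_max (theta_ratios gamma l),
      has_max (max_theta_ratios gamma) &
      max_set (max_theta_ratios gamma) >= Gamma_chi R * Num.sqrt (1 / gamma)].
Proof.
have hchi := has_max_chi_values R.
have hM := has_max_max_theta_ratios _ _ hgamma.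
split => //; first by move=> [//|l] _; exact: has_max_theta_ratios.
have /andP[g0 _] := hgamma.
have [_ Mub] := max_setP _ _ hM.
set M := max_set _ in Mub *.
have ratioM t l : 0 < t < 1 -> theta_ratio gamma l.+1 t <= M.
  move=> t01; apply: le_trans (_ : max_set (theta_ratios gamma l.+1) <= M).
    by apply: (max_setP _ _ (has_max_theta_ratios _ _ l hgamma)).2; exists t.
  by apply: Mub; exists l.+1.
(* Only one [t] is tested: the one given by a maximizer [u] of the quotient in [Gamma_chi]. *)
rewrite /Gamma_chi; have [[u /= u0 <-] _] := max_setP _ _ hchi.
pose t := expR (- u).
have t01 : 0 < t < 1 by rewrite expR_gt0 expR_lt1 oppr_lt0.
have /andP[t0 t1] := t01.
pose b := Num.sqrt (gamma * u / 2).
have b0 : 0 < b by rewrite sqrtr_gt0 divr_gt0 ?mulr_gt0.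
have tg : t `^ gamma = expR (- (2 * b ^+ 2)).
  rewrite /t -expRM sqr_sqrtr; last by rewrite ltW // divr_gt0 ?mulr_gt0.
  by congr expR; field.
have : Num.sqrt pi / (2 * b) <= M / (1 - t).
  apply: sum_bin2_lower_bound => // -[|l].
    rewrite big_ord0 divr_ge0 ?subr_ge0 ?(ltW t1) //.
    (* The one-term ratio is 1, which makes [M] nonnegative. *)
    by apply: le_trans (ratioM _ 0%N t01); rewrite theta_ratioE !big_ord1 expr0 divr1.
  rewrite -tg; have := ratioM _ l t01.
  rewrite theta_ratioE ler_pdivrMr ?sum_expr_gt0 ?(ltW t0) // => /le_trans; apply.
  rewrite ler_wpM2l //; last by rewrite sum_expr_le // (ltW t0).
  apply: le_trans (ratioM _ 0%N t01).
  by rewrite theta_ratioE !big_ord1 expr0 divr1.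
(* After multiplication by [1 - t], the left side equals the claimed bound, as [2 * b = Num.sqrt 2 *
   Num.sqrt (gamma * u)]. *)
rewrite ler_pdivlMr ?subr_gt0 //; apply: le_trans; rewrite le_eqVlt; apply/orP; left.
have s2 : Num.sqrt (2 : R) ^+ 2 = 2 by rewrite sqr_sqrtr.
have s20 : Num.sqrt (2 : R) != 0 by rewrite gt_eqF ?sqrtr_gt0.
have su0 : Num.sqrt u != 0 by rewrite gt_eqF ?sqrtr_gt0.
have sg0 : Num.sqrt gamma != 0 by rewrite gt_eqF ?sqrtr_gt0.
rewrite /b div1r !sqrtrM ?pi_ge0 ?mulr_ge0 ?(ltW g0) ?(ltW u0) //.
rewrite !sqrtrV ?(ltW g0) // -/t; apply/eqP.
(* Replacing 2 by [s ^+ 2] leaves an identity of rational functions in the square roots. *)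
move: (Num.sqrt 2) s2 s20 => s <- s0.
by field; rewrite s0 su0 sg0.
Qed.
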